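(* Let $\{X_n\}_{n\in\mathbb{N}}$ be a sequence of Hausdorff topological spaces, each equipped with a regular method (all denoted $G$), and let the product space $X=\prod_{n\in\mathbb{N}}X_n$ carry the coordinatewise product method (also denoted $G$). Then $X=\prod_{n\in\mathbb{N}}X_n$ is $G$-connected if and only if $X_n$ is $G$-connected for each $n\in\mathbb{N}$.
   Context: For a topological space $Z$, $s(Z)$ is the set of all sequences in $Z$ and $c(Z)$ the set of all convergent sequences in $Z$. A method on $Z$ is a function $G:c_G(Z)\to Z$ defined on a subset $c_G(Z)\subset s(Z)$. The method is regular if $c(Z)\subset c_G(Z)$ and $G(\mathbf{x})=\lim\mathbf{x}$ for every $\mathbf{x}\in c(Z)$. Product method: for spaces $X_n$ with methods $G$, a sequence $(x^k)_{k\in\mathbb{N}}$ in $\prod_n X_n$ belongs to $c_G(\prod_n X_n)$ if and only if for every $n$ the coordinate sequence $(\pi_n(x^k))_{k}$ belongs to $c_G(X_n)$, where $\pi_n$ is the projection to $X_n$; then $G((x^k)_k)=(G((\pi_n(x^k))_k))_{n}$. A subset $A\subset Z$ is $G$-closed if $G(\mathbf{x})\in A$ for every $\mathbf{x}\in s(A)\cap c_G(Z)$. A subset $F$ of $A\subset Z$ is $G$-closed in $A$ if $F=K\cap A$ for some $G$-closed $K\subset Z$. A non-empty subset $A\subset Z$ is $G$-connected if there are no non-empty disjoint subsets $F,K$ of $A$, both $G$-closed in $A$, with $A=F\cup K$. In particular a (non-empty) space $Z$ is $G$-connected if it is not the union of two non-empty disjoint $G$-closed subsets. *)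

(* Defs.v *)
From mathcomp Require Import all_boot all_classical topology.

Set Implicit Arguments.
Unset Strict Implicit.
Unset Printing Implicit Defensive.

Local Open Scope classical_set_scope.

Section Methods.
Variable Z : topologicalType.

Definition seqs_in (A : set Z) : set (nat -> Z) :=
  [set x | forall k, A (x k)].

Definition convergent_seqs : set (nat -> Z) :=
  [set x | exists l : Z, x @ \oo --> l].

(* The function is defined on the subtype given by [method_dom] only, so it has
   no values at other sequences. *)
Record method := Method {
  method_dom : set (nat -> Z);
  method_fun :> method_dom -> Z }.

(* [lim] needs a pointed space, hence the quantification over the limit [l],
   which is unique when [Z] is Hausdorff. *)
Definition regular_method (G : method) : Prop :=
  convergent_seqs `<=` method_dom G /\
  forall (x : method_dom G) (l : Z), val x @ \oo --> l -> G x = l.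

Definition G_closed (G : method) (A : set Z) : Prop :=
  forall x : method_dom G, seqs_in A (val x) -> A (G x).

Definition G_closed_in (G : method) (A F : set Z) : Prop :=
  exists K : set Z, G_closed G K /\ F = K `&` A.

Definition G_connected (G : method) (A : set Z) : Prop :=
  A !=set0 /\
  ~ exists F K : set Z,
      [/\ F !=set0 /\ K !=set0, F `&` K = set0,
          G_closed_in G A F, G_closed_in G A K & A = F `|` K].

End Methods.

Section ProductMethod.
Variables (X : nat -> topologicalType) (G : forall n, method (X n)).

Definition prod_method_dom : set (nat -> prod_topology X) :=
  [set x | forall n, method_dom (G n) (proj n \o x)].

Lemma prod_method_coord (x : prod_method_dom) (n : nat) :
  proj n \o val x \in method_dom (G n).
Proof. by apply: mem_set; have := set_valP x; apply. Qed.

Definition prod_method : method (prod_topology X) :=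
  @Method (prod_topology X) prod_method_dom
    (fun x n => G n (SigSub (prod_method_coord x n))).

End ProductMethod.

(* Main.v *)
Require Import Defs.
From mathcomp Require Import all_boot all_classical topology.

Local Open Scope classical_set_scope.

(** A separation of a factor pulls back to a separation of the product.
    Conversely, let [F] and its complement be [G]-closed in the product, and let
    [a] lie in [F]. Because regular methods fix constant sequences, the trace of
    [F] on a line parallel to a factor is [G]-closed in this factor, so
    connectedness of the factors lets one change finitely many coordinates of
    [a] without leaving [F]. For any [b], the points that agree with [b] before
    [k] and with [a] from [k] on are then in [F]; every coordinate of this
    sequence is eventually constant, so the product method sends it to [b],
    which is therefore in [F]. *)

Lemma method_ext {Z : topologicalType} {G : method Z} {x y : method_dom G} :
  val x = val y -> G x = G y.
Proof. by move=> /val_inj ->. Qed.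

Lemma G_closed_inT {Z : topologicalType} (G : method Z) (F : set Z) :
  G_closed_in G [set: Z] F <-> G_closed G F.
Proof.
split=> [[K [clK ->]]|clF]; first by rewrite setIT.
by exists F; rewrite setIT.
Qed.

(** Two disjoint sets that cover the space are complementary, so a separation amounts to one set,
    [G]-closed together with its complement. *)
Lemma G_connectedT {Z : topologicalType} (G : method Z) :
  G_connected G [set: Z] <->
  [set: Z] !=set0 /\
  forall F : set Z, G_closed G F -> G_closed G (~` F) -> F !=set0 -> F = setT.
Proof.
split=> -[Z0 conn]; split=> //.
  move=> F clF clFC F0; apply: contrapT => FT; apply: conn.
  exists F, (~` F); split; [split=> //|exact: setICr|..].
  - by apply/set0P/eqP => FC0; apply: FT; rewrite -(setCK F) FC0 setC0.
  - exact/G_closed_inT.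
  - exact/G_closed_inT.
  - by rewrite setUv.
move=> [F [K [[F0 [z Kz]] FK0 /G_closed_inT clF /G_closed_inT clK FUK]]].
have KE : K = ~` F.
  apply/seteqP; split=> [t Kt Ft|t nFt].
    by have : (F `&` K) t by []; rewrite FK0.
  by have : [set: Z] t by []; rewrite FUK => -[].
rewrite KE in clK Kz.
by apply: Kz; rewrite (conn F).
Qed.

(** Such a sequence converges to [l], so regularity applies. Quantifying over [y] makes the value
    independent of the proof of membership in the domain. *)
Lemma regular_eventually_cst {Z : topologicalType} {G : method Z}
    {x : nat -> Z} {l : Z} :
    regular_method G -> (\forall k \near \oo, x k = l) ->
  method_dom G x /\ forall y : method_dom G, val y = x -> G y = l.
Proof.
move=> [dom lim] xl.
have cvx : x @ \oo --> l by apply: cvg_near_cst.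
split; first by apply: dom; exists l.
by move=> y yx; apply: lim; rewrite yx.
Qed.

Section Product.
Context {X : nat -> topologicalType} {G : forall n, method (X n)}.

Lemma G_closed_proj (n : nat) (A : set (X n)) :
  G_closed (G n) A -> G_closed (prod_method G) (proj n @^-1` A).
Proof. by move=> clA x xA; apply: clA => k; apply: xA. Qed.

Lemma G_closed_dfwith (hG : forall n, regular_method (G n))
    (p : prod_topology X) (n : nat) (A : set (prod_topology X)) :
  G_closed (prod_method G) A ->
  G_closed (G n) [set y : X n | A (dfwith p n y)].
Proof.
move=> clA y yA.
pose x : nat -> prod_topology X := fun k => dfwith p n (val y k).
(* Coordinate [n] of the lifted sequence is [y] itself, already in the domain; the others are
   constant, and only there is regularity needed. *)
have xn : proj n \o x = val y by apply/funext => k; apply: dfwithin.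
have xm m : n != m -> \forall k \near \oo, (proj m \o x) k = p m.
  by move=> nm; near=> k; apply: dfwithout.
have domx : prod_method_dom G x.
  move=> m; have [<-|nm] := eqVneq n m; first by rewrite xn; apply: set_valP.
  exact: (regular_eventually_cst (hG m) (xm m nm)).1.
have := clA (SigSub (mem_set domx)) yA.
congr A; apply: functional_extensionality_dep => m /=.
have [<-|nm] := eqVneq n m; first by rewrite dfwithin; apply: method_ext.
rewrite dfwithout //.
exact: (regular_eventually_cst (hG m) (xm m nm)).2.
Unshelve. all: by end_near. Qed.

Definition splice (a b : prod_topology X) (k : nat) : prod_topology X :=
  fun n => if n < k then b n else a n.

Lemma spliceS (a b : prod_topology X) (k : nat) :
  splice a b k.+1 = dfwith (splice a b k) k (b k).
Proof.
apply: functional_extensionality_dep => n.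
have [<-|kn] := eqVneq k n; first by rewrite dfwithin /splice ltnSn.
by rewrite dfwithout // /splice ltnS leq_eqVlt eq_sym (negbTE kn).
Qed.

Lemma G_closed_splice (hG : forall n, regular_method (G n))
    (a b : prod_topology X) (A : set (prod_topology X)) :
  G_closed (prod_method G) A -> (forall k, A (splice a b k)) -> A b.
Proof.
move=> clA Aab.
(* Coordinate [n] is settled as soon as [k > n]; the threshold may depend on [n] because the method
   acts coordinatewise. *)
have ab n : \forall k \near \oo, (proj n \o splice a b) k = b n.
  near=> k; rewrite /= /proj /splice ifT //.
  by near: k; exact: nbhs_infty_gt.
have dom : prod_method_dom G (splice a b).
  by move=> n; exact: (regular_eventually_cst (hG n) (ab n)).1.
have := clA (SigSub (mem_set dom)) Aab.
congr A; apply: functional_extensionality_dep => n.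
exact: (regular_eventually_cst (hG n) (ab n)).2.
Unshelve. all: by end_near. Qed.

End Product.

Theorem theorem4p5 (X : nat -> topologicalType) (G : forall n, method (X n))
    (hX : forall n, hausdorff_space (X n))
    (hG : forall n, regular_method (G n)) :
  G_connected (prod_method G) [set: prod_topology X] <->
  (forall n, G_connected (G n) [set: X n]).
Proof.
split=> [/G_connectedT[[p _] conn] n|conn].
  apply/G_connectedT; split; first by exists (p n).
  move=> F clF clFC [y Fy].
  have projF : proj n @^-1` F = [set: prod_topology X].
    (* Preimages commute with complements by computation. *)
    apply: conn; [exact: G_closed_proj|exact: (G_closed_proj n (~` F))|].
    by exists (dfwith p n y); rewrite /= /proj dfwithin.
  apply/seteqP; split=> // z _.
  have : (proj n @^-1` F) (dfwith p n z) by rewrite projF.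
  by rewrite /= /proj dfwithin.
apply/G_connectedT; split.
  by exists (fun n => projT1 (cid (conn n).1)).
move=> F clF clFC [a Fa]; apply/seteqP; split=> // b _.
(* [splice a b 0] computes to [a], which settles the base case. *)
apply: (G_closed_splice hG a b) => //; elim=> [//|k IHk].
have /G_connectedT[_ connk] := conn k.
have lineT : [set y : X k | F (dfwith (splice a b k) k y)] = setT.
  apply: connk; [exact: G_closed_dfwith|exact: (G_closed_dfwith hG _ _ (~` F))|].
  (* The line passes through [splice a b k], which is in [F] by induction. *)
  exists (splice a b k k) => /=; congr F: IHk.
  apply: functional_extensionality_dep => n.
  by have [<-|kn] := eqVneq k n; rewrite ?dfwithin ?dfwithout.
have : [set y : X k | F (dfwith (splice a b k) k y)] (b k) by rewrite lineT.
by rewrite spliceS.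
Qed.
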